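(* Let $n=k+m$, $1\le k<n$, and in the algebra $\mathfrak{gl}_{k,m}$ put $e_x=L^{(1)}_{x,x+1}$, $f_x=L^{(1)}_{x+1,x}$ for $x\in[n-1]$ and $\epsilon_x=L^{(1)}_{x,x}$ for $x\in[n]$. Write $[\mathrm a,\mathrm b]=\mathrm a\mathrm b-\mathrm b\mathrm a$ and $[[\mathrm a,\mathrm b]]=\mathrm a\mathrm b+\mathrm b\mathrm a$. Then the following relations hold (for all indices for which the generators involved are defined): \begin{itemize} \item $[h_x,h_y]=0$ for $x,y\in X_k^+$; $[\epsilon_z,h_x]=0$ for $z\in[n]$; \item $[e_x,h_z]=[f_x,h_z]=0$ for $z\ne x,x+1$; \item $[[\xi_x,h_x]]=[[\xi_x,h_{x+1}]]=0$ for $\xi_x\in\{e_x,f_x\}$ and $x,x+1\in X_k^+$; \item $[\epsilon_y,e_x]=[\epsilon_y,f_x]=0$ for $y\neq x,x+1$; \item $[\epsilon_x,e_x]=-e_x$, $[\epsilon_x,f_x]=f_x$ for $x\in[k]$; \item $[\epsilon_{x+1},e_x]=e_x$, $[\epsilon_{x+1},f_x]=-f_x$ for $x+1\in[k]$; \item $[[\epsilon_x,e_x]]=h_xe_x$, $[[\epsilon_x,f_x]]=-h_xf_x$ for $x\in X_k^+$; \item $[[\epsilon_{x+1},e_x]]=-h_{x+1}e_x$, $[[\epsilon_{x+1},f_x]]=h_{x+1}f_x$ for $x+1\in X_k^+$; \item $[f_x,e_x]=\epsilon_xh_{x+1}-\epsilon_{x+1}h_x$ for $x\in[n-1]$; \item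 $[f_x,e_y]=0$ for $x\ne y$ both in $[k]$, and for $y\ne x,x\pm1$ if $x,x+1\in X_k^+$; \item $[[f_x,e_{x+1}]]=0$ for $x+1\in X_k^+$; $[[f_x,e_{x-1}]]=0$ for $x\in X_k^+$. \end{itemize} Moreover $e_k^2=f_k^2=0$; and, with $\xi$ denoting throughout either $e$ or $f$, $$\xi_{x\pm1}\xi_x^2+\xi_x^2\xi_{x\pm1}-2\xi_x\xi_{x\pm1}\xi_x=0\quad\text{for } x\ne k,\qquad \big[\big[\,[\xi_{k+1},\xi_k],\,[\xi_k,\xi_{k-1}]\,\big]\big]=0,$$ whenever all the indices lie in $[n-1]$.
   Context: $[n]=\{1,\dots,n\}$, $X_k^+=\{k+1,\dots,n\}$, $\mathbf 1_{x\in X_k^+}$ is $1$ if $x\in X_k^+$ and $0$ otherwise. $\mathfrak{gl}_{k,m}$ ($k+m=n$) is the unital associative $\mathbb C$-algebra generated by invertible elements $h_z$, $z\in X_k^+$, and $L^{(1)}_{x,y}$, $x,y\in[n]$, with the relations (where $h_z:=1$ for $z\in[k]$) $$[h_x,h_y]=0\ (x,y\in X_k^+),\qquad [L^{(1)}_{x,y},h_z]=2L^{(1)}_{x,y}h_x\delta_{z,x}-2h_yL^{(1)}_{x,y}\delta_{y,z}\ (z\in X_k^+),$$ $$[L^{(1)}_{x,y},L^{(1)}_{z,w}]-2L^{(1)}_{x,y}L^{(1)}_{x,w}\,\delta_{x,z}\mathbf 1_{x\in X_k^+}+2L^{(1)}_{z,y}L^{(1)}_{x,y}\,\delta_{y,w}\mathbf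 1_{y\in X_k^+}=L^{(1)}_{z,y}h_x\delta_{x,w}-h_yL^{(1)}_{x,w}\delta_{y,z}.$$ *)

(* Defs.v *)
From HB Require Import structures.
From mathcomp Require Import all_boot all_order all_algebra.
From mathcomp Require Import generic_quotient ring_quotient.
From mathcomp Require Import boolp.
From mathcomp.multinomials Require Import monalg.

Set Implicit Arguments.
Unset Strict Implicit.
Unset Printing Implicit Defensive.

Import GRing.Theory.
Local Open Scope ring_scope.
Local Open Scope quotient_scope.

Section FreeAlgebra.
Variables (K : comNzRingType) (X : choiceType).

(* Noncommutative polynomials: [{fmonom X}] is the free monoid on [X]. *)
Definition free_alg : Type := {malg K[{fmonom X}]}.
HB.instance Definition _ := GRing.Lalgebra.on free_alg.

Definition free_gen (x : X) : free_alg := mkmalgU (fmu x) 1.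

Lemma free_alg_scaleAr (c : K) (a b : free_alg) : c *: (a * b) = a * (c *: b).
Proof.
pose M : Type := {malg K[{fmonom X}]}.
have UU (k1 k2 : {fmonom X}) (c1 c2 : K) :
    (mkmalgU k1 c1 : M) * mkmalgU k2 c2 = mkmalgU (mmul k1 k2) (c1 * c2).
  by rewrite malgM_def fgmulUU.
have ZU (k1 : {fmonom X}) (c1 : K) :
    c *: (mkmalgU k1 c1 : M) = mkmalgU k1 (c * c1).
  by apply/malgP => k; rewrite mcoeffZ !mcoeffU mulrnAr.
change ((c *: ((a : M) * (b : M)) : M) = (a : M) * (c *: (b : M))).
rewrite [a : M]monalgE [b : M]monalgE mulr_suml !scaler_sumr mulr_suml.
apply: eq_bigr => k1 _; rewrite !mulr_sumr scaler_sumr.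
by apply: eq_bigr => k2 _; rewrite ZU !UU ZU mulrCA.
Qed.

HB.instance Definition _ :=
  GRing.Lalgebra_isAlgebra.Build K free_alg free_alg_scaleAr.

Section Evaluation.
Variable v : X -> K.

Definition free_eval_monom (w : {fmonom X}) : K := \prod_(x <- w) v x.

Lemma free_eval_monom_mmorphism : mmorphism free_eval_monom.
Proof.
by split=> [a b|]; rewrite /free_eval_monom ?fmM ?big_cat // fm1 big_nil.
Qed.

HB.instance Definition _ :=
  isMultiplicative.Build _ K free_eval_monom free_eval_monom_mmorphism.

Definition free_eval (a : free_alg) : K := mmap idfun free_eval_monom a.

Lemma free_eval_zmod_morphism : zmod_morphism free_eval.
Proof. exact: (@mmapB _ _ _ idfun free_eval_monom). Qed.

Lemma free_eval_monoid_morphism : monoid_morphism free_eval.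
Proof.
split; first exact: (@mmap1 _ _ _ idfun free_eval_monom).
exact: (@mmap_is_multiplicative _ _ _ idfun free_eval_monom).1.
Qed.

HB.instance Definition _ :=
  GRing.isZmodMorphism.Build free_alg K free_eval free_eval_zmod_morphism.
HB.instance Definition _ :=
  GRing.isMonoidMorphism.Build free_alg K free_eval free_eval_monoid_morphism.

Lemma free_evalZ c a : free_eval (c *: a) = c * free_eval a.
Proof. exact: (@mmapZ _ _ _ idfun free_eval_monom). Qed.

Lemma free_eval_gen x : free_eval (free_gen x) = v x.
Proof.
rewrite /free_eval /free_gen mmapU mul1r /free_eval_monom fmU.
by rewrite big_seq1.
Qed.

End Evaluation.

End FreeAlgebra.

Section QuotientAlgebra.
Variables (K : comNzRingType) (F : algType K).
Variable rel : F -> F -> Prop.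

(* The two-sided ideal generated by the [a - b] for [rel a b]. *)
Inductive rel_ideal : F -> Prop :=
| rel_ideal_gen a b of rel a b : rel_ideal (a - b)
| rel_ideal0 : rel_ideal 0
| rel_idealB a b of rel_ideal a & rel_ideal b : rel_ideal (a - b)
| rel_idealMl a b of rel_ideal b : rel_ideal (a * b)
| rel_idealMr a b of rel_ideal a : rel_ideal (a * b).

Definition rel_ideal_pred : F -> bool := fun a => `[< rel_ideal a >].

Lemma rel_ideal_zmod_closed : zmod_closed rel_ideal_pred.
Proof.
split=> [|a b /asboolP ia /asboolP ib]; apply/asboolP; first exact: rel_ideal0.
exact: rel_idealB.
Qed.

HB.instance Definition _ :=
  GRing.isZmodClosed.Build F rel_ideal_pred rel_ideal_zmod_closed.

Definition rel_idealC : zmodClosed F :=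
  GRing.ZmodClosed.clone F rel_ideal_pred _.
Definition quot_alg : Type := Quotient.quot rel_idealC.
Local Notation A := quot_alg.
HB.instance Definition _ := GRing.Zmodule.on A.
HB.instance Definition _ := Quotient.on A.

Definition quot_pi (a : F) : A := \pi_(Quotient.quot rel_idealC) a.

Lemma quot_piP (a b : F) :
  reflect (rel_ideal (a - b)) (quot_pi a == quot_pi b).
Proof. by rewrite /quot_pi -Quotient.idealrBE; apply: asboolP. Qed.

Lemma quot_piE (a b : F) : rel_ideal (a - b) -> quot_pi a = quot_pi b.
Proof. by move/quot_piP/eqP. Qed.

Lemma quot_rel a b : rel a b -> quot_pi a = quot_pi b.
Proof. by move=> ab; apply/quot_piE/rel_ideal_gen. Qed.

Lemma quot_repr (x : A) : quot_pi (repr x) = x.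
Proof. exact: reprK. Qed.

Lemma quot_piB : {morph quot_pi : a b / a - b}.
Proof. by move=> a b; rewrite /quot_pi !piE. Qed.

Lemma quot_piD : {morph quot_pi : a b / a + b}.
Proof. by move=> a b; rewrite /quot_pi !piE. Qed.

Lemma quot_repr_pi (a : F) : rel_ideal (a - repr (quot_pi a)).
Proof. by apply/quot_piP; rewrite quot_repr. Qed.

Definition quot_one : A := quot_pi 1.
Definition quot_mul (x y : A) : A := quot_pi (repr x * repr y).
Definition quot_scale (c : K) (x : A) : A := quot_pi (c *: repr x).

Lemma quot_piM a b : quot_pi (a * b) = quot_mul (quot_pi a) (quot_pi b).
Proof.
apply: quot_piE; set a' := repr _; set b' := repr _.
have -> : a * b - a' * b' = (a - a') * b - a' * (b' - b).
  by rewrite mulrBl mulrBr opprB addrA addrNK.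
apply: rel_idealB; first exact/rel_idealMr/quot_repr_pi.
rewrite -opprB -mulN1r; do 2!apply: rel_idealMl.
exact: quot_repr_pi.
Qed.

Lemma quot_piZ c a : quot_pi (c *: a) = quot_scale c (quot_pi a).
Proof.
apply: quot_piE; rewrite -scalerBr -mulr_algl.
exact/rel_idealMl/quot_repr_pi.
Qed.

Lemma quot_mulA : associative quot_mul.
Proof.
move=> x y z; rewrite -[x]quot_repr -[y]quot_repr -[z]quot_repr.
by rewrite -!quot_piM mulrA.
Qed.

Lemma quot_mul1r : left_id quot_one quot_mul.
Proof. by move=> x; rewrite -[x]quot_repr -quot_piM mul1r. Qed.

Lemma quot_mulr1 : right_id quot_one quot_mul.
Proof. by move=> x; rewrite -[x]quot_repr -quot_piM mulr1. Qed.

Lemma quot_mulDl : left_distributive quot_mul +%R.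
Proof.
move=> x y z; rewrite -[x]quot_repr -[y]quot_repr -[z]quot_repr.
by rewrite -quot_piD -!quot_piM mulrDl quot_piD.
Qed.

Lemma quot_mulDr : right_distributive quot_mul +%R.
Proof.
move=> x y z; rewrite -[x]quot_repr -[y]quot_repr -[z]quot_repr.
by rewrite -quot_piD -!quot_piM mulrDr quot_piD.
Qed.

(* The quotient is trivial when the ideal is everything. *)
HB.instance Definition _ := GRing.Zmodule_isPzRing.Build A
  quot_mulA quot_mul1r quot_mulr1 quot_mulDl quot_mulDr.

Lemma quot_pi_is_zmod_morphism : zmod_morphism quot_pi.
Proof. exact: quot_piB. Qed.

Lemma quot_pi_is_monoid_morphism : monoid_morphism quot_pi.
Proof. by split; [apply: erefl | apply: quot_piM]. Qed.

HB.instance Definition _ :=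
  GRing.isZmodMorphism.Build F A quot_pi quot_pi_is_zmod_morphism.
HB.instance Definition _ :=
  GRing.isMonoidMorphism.Build F A quot_pi quot_pi_is_monoid_morphism.

Lemma quot_scaleA c d x : quot_scale c (quot_scale d x) = quot_scale (c * d) x.
Proof. by rewrite -[x]quot_repr -!quot_piZ scalerA. Qed.

Lemma quot_scale1 : left_id 1 quot_scale.
Proof. by move=> x; rewrite -[x]quot_repr -quot_piZ scale1r. Qed.

Lemma quot_scaleDr : right_distributive quot_scale +%R.
Proof.
move=> c x y; rewrite -[x]quot_repr -[y]quot_repr.
by rewrite -quot_piD -!quot_piZ scalerDr quot_piD.
Qed.

Lemma quot_scaleDl x : {morph quot_scale^~ x : c d / c + d >-> c + d}.
Proof.
by move=> c d; rewrite -[x]quot_repr -!quot_piZ scalerDl; apply: quot_piD.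
Qed.

HB.instance Definition _ := GRing.Zmodule_isLmodule.Build K A
  quot_scaleA quot_scale1 quot_scaleDr quot_scaleDl.

Lemma quot_pi_scalable : scalable quot_pi.
Proof. exact: quot_piZ. Qed.

HB.instance Definition _ :=
  GRing.isScalable.Build K F A *:%R quot_pi quot_pi_scalable.

Lemma quot_scaleAl (c : K) (x y : A) : c *: (x * y) = c *: x * y.
Proof.
rewrite -[x]quot_repr -[y]quot_repr -rmorphM /= -!quot_pi_scalable.
by rewrite scalerAl rmorphM.
Qed.

Lemma quot_scaleAr (c : K) (x y : A) : c *: (x * y) = x * (c *: y).
Proof.
rewrite -[x]quot_repr -[y]quot_repr -rmorphM /= -!quot_pi_scalable.
by rewrite scalerAr rmorphM.
Qed.

Lemma quot_alg_neq0 (phi : {rmorphism F -> K}) :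
  (forall a b, rel a b -> phi a = phi b) -> 1 != 0 :> A.
Proof.
move=> phi_rel.
have phi0 a : rel_ideal a -> phi a = 0.
  elim=> {a} [a b /phi_rel ab||a b _ a0 _ b0|a b _ b0|a b _ a0].
  - by rewrite rmorphB ab subrr.
  - exact: rmorph0.
  - by rewrite rmorphB a0 b0 subrr.
  - by rewrite rmorphM b0 mulr0.
  - by rewrite rmorphM a0 mul0r.
apply/negP; rewrite -(rmorph1 quot_pi) -(rmorph0 quot_pi).
by move=> /quot_piP/phi0/eqP; rewrite subr0 rmorph1 oner_eq0.
Qed.

End QuotientAlgebra.

Definition commutator (A : pzRingType) (a b : A) : A := a * b - b * a.
Definition anticommutator (A : pzRingType) (a b : A) : A := a * b + b * a.

(* Membership in [n] = {1, ..., n} and in X_k^+ = {k + 1, ..., n}. *)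
Definition in_segment (n x : nat) : bool := (1 <= x <= n)%N.
Definition in_Xplus (k n x : nat) : bool := (k < x <= n)%N.

Section Relations.
Variables (K : comNzRingType) (k m : nat).
Local Notation n := (k + m)%N.
Local Notation N := (in_segment n).
Local Notation Xp := (in_Xplus k n).
Local Notation δ x y := ((x == y)%:R : K).
Local Notation ind x := ((Xp x)%:R : K).

Section Def.
Variables (A : algType K) (h hinv : nat -> A) (L : nat -> nat -> A).

(* [hinv z] is the inverse of [h z]: the first two families of relations say
   that the generators [h z] are invertible. *)
Inductive gl_rel : A -> A -> Prop :=
| gl_rel_hV z of Xp z : gl_rel (h z * hinv z) 1
| gl_rel_Vh z of Xp z : gl_rel (hinv z * h z) 1
| gl_rel_hh x y of Xp x & Xp y : gl_rel (commutator (h x) (h y)) 0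
| gl_rel_Lh x y z of N x & N y & Xp z :
    gl_rel (commutator (L x y) (h z))
      ((2 * δ z x) *: (L x y * h x) - (2 * δ y z) *: (h y * L x y))
| gl_rel_LL x y z w of N x & N y & N z & N w :
    gl_rel (commutator (L x y) (L z w)
              - (2 * δ x z * ind x) *: (L x y * L x w)
              + (2 * δ y w * ind y) *: (L z y * L x y))
      (δ x w *: (L z y * h x) - δ y z *: (h y * L x w)).

End Def.

Lemma gl_rel_augmentation (A : algType K) (h hinv : nat -> A)
    (L : nat -> nat -> A) (phi : {rmorphism A -> K}) :
    (forall c a, phi (c *: a) = c * phi a) ->
    (forall z, phi (h z) = 1) -> (forall z, phi (hinv z) = 1) ->
    (forall x y, phi (L x y) = 0) ->
  forall a b, gl_rel h hinv L a b -> phi a = phi b.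
Proof.
move=> phiZ ph phV pL a b.
case=> [z _|z _|x y _ _|x y z _ _ _|x y z w _ _ _ _];
  rewrite /commutator !(rmorphD, rmorphN, rmorphM, rmorph1, rmorph0, phiZ) /=;
  by rewrite ?(ph, phV, pL, mulr1, mulr0, mul0r, subrr, addr0).
Qed.

Lemma gl_rel_morph (A B : algType K) (h hinv : nat -> A)
    (L : nat -> nat -> A) (phi : {lrmorphism A -> B}) :
    (forall a b, gl_rel h hinv L a b -> phi a = phi b) ->
  forall a b,
    gl_rel (phi \o h) (phi \o hinv) (fun x y => phi (L x y)) a b -> a = b.
Proof.
move=> phi_rel a b.
have phiZ c u : phi (c *: u) = c *: phi u by exact: linearZ.
have phiM : {morph phi : u w / u * w} by exact: rmorphM.
have phiD : {morph phi : u w / u + w} by exact: rmorphD.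
have phiB : {morph phi : u w / u - w} by exact: rmorphB.
case=> [z zX|z zX|x y xX yX|x y z xN yN zX|x y z w xN yN zN wN].
- by have /phi_rel := gl_rel_hV h hinv L zX; rewrite rmorphM rmorph1.
- by have /phi_rel := gl_rel_Vh h hinv L zX; rewrite rmorphM rmorph1.
- have /phi_rel := gl_rel_hh h hinv L xX yX.
  by rewrite /commutator phiB !phiM rmorph0.
- have /phi_rel := gl_rel_Lh h hinv L xN yN zX.
  by rewrite /commutator !phiB !phiZ !phiM.
- have /phi_rel := gl_rel_LL h hinv L xN yN zN wN.
  by rewrite /commutator !(phiB, phiD) !phiZ !phiM.
Qed.

End Relations.

Section Glkm.
Variables (K : comNzRingType) (k m : nat).
Local Notation n := (k + m)%N.

Inductive gl_gen : Type :=
| GenH of {z : nat | in_Xplus k n z}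
| GenHinv of {z : nat | in_Xplus k n z}
| GenL of {x : nat | in_segment n x} & {y : nat | in_segment n y}.

HB.instance Definition _ := gen_eqMixin gl_gen.
HB.instance Definition _ := gen_choiceMixin gl_gen.

Local Notation F := (free_alg K gl_gen).

(* [free_h z] is 1 for z in [k], by convention; the values of [free_h],
   [free_hinv] and [free_L] outside of the index ranges are irrelevant. *)
Definition free_h (z : nat) : F :=
  if insub z is Some i then free_gen K (GenH i) else 1.
Definition free_hinv (z : nat) : F :=
  if insub z is Some i then free_gen K (GenHinv i) else 1.
Definition free_L (x y : nat) : F :=
  match insub x, insub y with
  | Some i, Some j => free_gen K (GenL i j)
  | _, _ => 0
  end.

Definition gl_presentation : F -> F -> Prop :=
  gl_rel k m free_h free_hinv free_L.

Definition gl : Type := quot_alg gl_presentation.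
HB.instance Definition _ := GRing.PzRing.on gl.
HB.instance Definition _ := GRing.Lmodule.on gl.

Lemma gl_neq0 : 1 != 0 :> gl.
Proof.
pose v (x : gl_gen) : K := if x is GenL _ _ then 0 else 1.
apply: (quot_alg_neq0 (phi := free_eval v)).
apply: gl_rel_augmentation => [c a|z|z|x y]; first exact: free_evalZ.
- rewrite /free_h; case: insub => [i|]; first exact: free_eval_gen.
  exact: (rmorph1 (free_eval v)).
- rewrite /free_hinv; case: insub => [i|]; first exact: free_eval_gen.
  exact: (rmorph1 (free_eval v)).
- rewrite /free_L; case: insub => [i|]; last exact: (rmorph0 (free_eval v)).
  case: insub => [j|]; first exact: free_eval_gen.
  exact: (rmorph0 (free_eval v)).
Qed.

HB.instance Definition _ := GRing.PzSemiRing_isNonZero.Build gl gl_neq0.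
HB.instance Definition _ :=
  GRing.Lmodule_isLalgebra.Build K gl (@quot_scaleAl _ _ gl_presentation).
HB.instance Definition _ :=
  GRing.Lalgebra_isAlgebra.Build K gl (@quot_scaleAr _ _ gl_presentation).

Definition gl_pi : F -> gl := quot_pi gl_presentation.
HB.instance Definition _ := GRing.LRMorphism.on gl_pi.

Definition gl_h (z : nat) : gl := gl_pi (free_h z).
Definition gl_hinv (z : nat) : gl := gl_pi (free_hinv z).
Definition gl_L (x y : nat) : gl := gl_pi (free_L x y).

Lemma gl_h1 z : (z <= k)%N -> gl_h z = 1.
Proof.
rewrite leqNgt /gl_h /free_h => zk.
by rewrite insubF ?rmorph1 // /in_Xplus (negbTE zk).
Qed.

Lemma gl_relE a b : gl_rel k m gl_h gl_hinv gl_L a b -> a = b.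
Proof. exact: (@gl_rel_morph _ _ _ _ _ _ _ _ gl_pi (@quot_rel _ _ _)). Qed.

Definition gl_e (x : nat) : gl := gl_L x x.+1.
Definition gl_f (x : nat) : gl := gl_L x.+1 x.
Definition gl_eps (x : nat) : gl := gl_L x x.

End Glkm.

(* Main.v *)
(* Writing the composite step as [M = L a c], the relations give
   [[L a b, L b c] = - h b * M] for distinct indices, and [L a b] commutes or
   anticommutes with each of [M] and [h b] according to the position of [a] and
   [b] relative to [k].  When [a] and [b] lie on the same side of [k] the two
   signs agree, so [L a b] commutes with [h b * M]: this is the Serre relation.
   The quartic relation at [k] reduces in the same way to the vanishing of a
   commutator of two generators [L] without common index. *)

Require Import Defs.
From mathcomp Require Import all_boot all_order all_algebra.
From mathcomp Require Import complex reals zify.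

Import GRing.Theory.
Local Open Scope ring_scope.

(** * Commutators and anticommutators in a ring *)

Section RingCommutators.
Set Implicit Arguments.
Unset Strict Implicit.
Variable A : pzRingType.
Implicit Types x y z : A.

Lemma commutator_eq0 x y : commutator x y = 0 <-> x * y = y * x.
Proof. by split=> [/subr0_eq //|xy]; rewrite /commutator xy subrr. Qed.

Lemma anticommutator_eq0 x y : anticommutator x y = 0 <-> x * y = - (y * x).
Proof.
by split=> [/eqP|xy]; rewrite /anticommutator ?xy ?addNr // addr_eq0 => /eqP.
Qed.

Lemma anticommutatorC x y : anticommutator x y = anticommutator y x.
Proof. exact: addrC. Qed.

Lemma commutatorN x y : - commutator x y = commutator y x.
Proof. exact: opprB. Qed.

Lemma commutatorNr x y : commutator x (- y) = - commutator x y.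
Proof. by rewrite /commutator mulrN mulNr opprB opprK addrC. Qed.

(** The correction terms with coefficient 2 in the defining relations have this shape or that of
    [commutatorB_double]; this is how indices in $X_k^+$ produce anticommutators. *)
Lemma commutatorD_double x y :
  commutator x y + 2 * (y * x) = anticommutator x y.
Proof.
by rewrite /commutator /anticommutator mulr_natl mulr2n addrA addrNK.
Qed.

Lemma commutatorB_double x y :
  commutator x y - 2 * (x * y) = - anticommutator x y.
Proof.
rewrite /commutator /anticommutator mulr_natl mulr2n opprD addrA.
by rewrite (addrAC (x * y)) subrr sub0r addrC opprD.
Qed.

Lemma commutatorMN x y z : anticommutator x y = 0 -> anticommutator x z = 0 ->
  commutator x (y * z) = 0.
Proof.
move=> /anticommutator_eq0 xy /anticommutator_eq0 xz; apply/commutator_eq0.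
by rewrite mulrA xy mulNr -mulrA xz mulrN opprK mulrA.
Qed.

(** The right-hand side is the Serre expression, so a Serre relation is the vanishing of a double
    commutator. *)
Lemma double_commutator x y :
  commutator x (commutator x y) = y * x ^+ 2 + x ^+ 2 * y - 2 * (x * y * x).
Proof.
rewrite /commutator mulrBr mulrBl opprB mulr_natl mulr2n opprD !expr2 !mulrA.
by rewrite addrACA (addrC (y * x * x)).
Qed.

End RingCommutators.

(** * The defining relations in an abstract algebra *)

Section Relations.
Set Implicit Arguments.
Unset Strict Implicit.
Variables (K : comNzRingType) (k m : nat).
Local Notation n := (k + m)%N.
Local Notation N := (in_segment n).
Local Notation Xp := (in_Xplus k n).
(** Arbitrary families satisfying the presentation are considered, so the quotient construction does
    not enter; in [K] the element 2 may fail to be invertible. *)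
Variables (A : algType K) (h hinv : nat -> A) (L : nat -> nat -> A).
Hypothesis gl_relP : forall u v, gl_rel k m h hinv L u v -> u = v.
Hypothesis h_out : forall z, ~~ Xp z -> h z = 1.
Implicit Types a b c d z : nat.

Lemma gl_relLh a b z : N a -> N b -> Xp z ->
  commutator (L a b) (h z) =
    (2 * (z == a)%:R) *: (L a b * h a) - (2 * (b == z)%:R) *: (h b * L a b).
Proof. by move=> *; apply/gl_relP/gl_rel_Lh. Qed.

Lemma gl_relLL a b c d : N a -> N b -> N c -> N d ->
  commutator (L a b) (L c d)
    - (2 * (a == c)%:R * (Xp a)%:R) *: (L a b * L a d)
    + (2 * (b == d)%:R * (Xp b)%:R) *: (L c b * L a b) =
  (a == d)%:R *: (L c b * h a) - (b == c)%:R *: (h b * L a d).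
Proof. by move=> *; apply/gl_relP/gl_rel_LL. Qed.

Lemma scale2r (x : A) : (2 : K) *: x = 2 * x.
Proof. by rewrite scaler_nat mulr_natl. Qed.

Let simp := (eqxx, mulr0, mul0r, mulr1, mul1r, scale0r, scale1r, scale2r,
  subr0, sub0r, addr0, add0r, oppr0).

Lemma gl_hh_comm a b : commutator (h a) (h b) = 0.
Proof.
have [aX|/h_out->] := boolP (Xp a); last first.
  by rewrite /commutator !simp subrr.
have [bX|/h_out->] := boolP (Xp b); last first.
  by rewrite /commutator !simp subrr.
exact/gl_relP/gl_rel_hh.
Qed.

(** * Relations between the $L_{a,b}$ and the $h_z$ *)

Lemma gl_Lh_comm a b z : N a -> N b -> z != a -> z != b ->
  commutator (L a b) (h z) = 0.
Proof.
move=> aN bN za zb.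
have [zX|/h_out->] := boolP (Xp z); last first.
  by rewrite /commutator !simp subrr.
by rewrite gl_relLh // (negbTE za) (eq_sym b) (negbTE zb) !simp.
Qed.

Lemma gl_eps_h_comm a z : N a -> commutator (L a a) (h z) = 0.
Proof.
move=> aN; have [->|za] := eqVneq z a; last exact: gl_Lh_comm.
have [aX|/h_out->] := boolP (Xp a); last first.
  by rewrite /commutator !simp subrr.
(* With all indices equal the relation reads $c=2c$ for $c=[L_{a,a},h_a]$, and cancelling one $c$
   avoids dividing by 2. *)
have := gl_relLh aN aN aX; rewrite !simp -mulrBr -/(commutator _ _).
by rewrite mulr_natl mulr2n -[LHS]addr0 => /addrI.
Qed.

(** As $a\ne b$, exactly one delta term survives, and its factor 2 turns the commutator into an
    anticommutator. *)
Lemma gl_Lh_anti a b z : N a -> N b -> a != b -> Xp z -> z \in [:: a; b] ->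
  anticommutator (L a b) (h z) = 0.
Proof.
move=> aN bN ab zX; rewrite !inE => zab; have := gl_relLh aN bN zX.
case/orP: zab => /eqP Ez; subst z; rewrite eqxx ?(eq_sym b) (negbTE ab) !simp.
  move=> /eqP; rewrite -subr_eq0 commutatorB_double oppr_eq0.
  by move=> /eqP.
move=> /eqP; rewrite -addr_eq0 commutatorD_double.
by move=> /eqP.
Qed.

(** * Quadratic relations among the $L_{a,b}$ *)

(** The last four hypotheses switch off the four delta terms one by one. *)
Lemma gl_LL_comm a b c d : N a -> N b -> N c -> N d ->
  a != d -> b != c -> ~~ ((a == c) && Xp a) -> ~~ ((b == d) && Xp b) ->
  commutator (L a b) (L c d) = 0.
Proof.
move=> aN bN cN dN ad bc ac bd; have := gl_relLL aN bN cN dN.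
rewrite -!mulrA -!natrM !mulnb (negbTE ad) (negbTE bc) (negbTE ac) (negbTE bd).
by rewrite !simp.
Qed.

Lemma gl_LL_row a b c : N a -> N b -> N c -> a != b -> a != c -> b != c ->
  Xp a -> anticommutator (L a b) (L a c) = 0.
Proof.
move=> aN bN cN ab ac bc aX; have := gl_relLL aN bN aN cN.
rewrite aX (negbTE ac) (negbTE bc) (eq_sym b) (negbTE ab) !simp.
by rewrite commutatorB_double => /eqP; rewrite oppr_eq0 => /eqP.
Qed.

Lemma gl_LL_col a b c : N a -> N b -> N c -> a != b -> a != c -> b != c ->
  Xp c -> anticommutator (L a c) (L b c) = 0.
Proof.
move=> aN bN cN ab ac bc cX; have := gl_relLL aN cN bN cN.
rewrite cX (negbTE ac) (negbTE ab) (eq_sym c) (negbTE bc) !simp.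
by rewrite commutatorD_double.
Qed.

Lemma gl_LL_chain a b c : N a -> N b -> N c -> a != b -> a != c -> b != c ->
  commutator (L a b) (L b c) = - (h b * L a c).
Proof.
move=> aN bN cN ab ac bc; have := gl_relLL aN bN bN cN.
by rewrite (negbTE ac) (negbTE ab) (negbTE bc) !simp.
Qed.

Lemma gl_LL_swap a b : N a -> N b -> a != b ->
  commutator (L a b) (L b a) = L b b * h a - L a a * h b.
Proof.
move=> aN bN ab; have := gl_relLL aN bN bN aN.
rewrite (negbTE ab) (eq_sym b) (negbTE ab) !simp => ->.
by have /commutator_eq0-> := gl_eps_h_comm b aN.
Qed.

(** In the relation of $L_{a,b}$ with itself the commutator vanishes and exactly one of the two
    correction terms survives, leaving $\pm 2L_{a,b}^2=0$. *)
Lemma gl_LL_square a b : N a -> N b -> a != b -> Xp a != Xp b ->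
  2 * L a b ^+ 2 = 0.
Proof.
move=> aN bN ab abX; have := gl_relLL aN bN aN bN.
rewrite /commutator subrr (negbTE ab) (eq_sym b) (negbTE ab) !simp expr2.
case: (Xp a) (Xp b) abX => [] [] // _; rewrite !simp // => /eqP.
by rewrite oppr_eq0 => /eqP.
Qed.

(** * The diagonal generators $L_{a,a}$ against the others *)

Lemma gl_eps_row_lo a b : N a -> N b -> a != b -> ~~ Xp a ->
  commutator (L a a) (L a b) = - L a b.
Proof.
move=> aN bN ab aX; have := gl_relLL aN aN aN bN.
by rewrite (negbTE ab) (negbTE aX) (h_out aX) !simp.
Qed.

Lemma gl_eps_col_lo a b : N a -> N b -> a != b -> ~~ Xp a ->
  commutator (L a a) (L b a) = L b a.
Proof.
move=> aN bN ab aX; have := gl_relLL aN aN bN aN.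
by rewrite (negbTE ab) (negbTE aX) (h_out aX) !simp.
Qed.

Lemma gl_eps_row_hi a b : N a -> N b -> a != b -> Xp a ->
  anticommutator (L a a) (L a b) = h a * L a b.
Proof.
move=> aN bN ab aX; have := gl_relLL aN aN aN bN.
by rewrite (negbTE ab) aX !simp commutatorB_double => /oppr_inj.
Qed.

Lemma gl_eps_col_hi a b : N a -> N b -> a != b -> Xp a ->
  anticommutator (L a a) (L b a) = - (h a * L b a).
Proof.
move=> aN bN ab aX; have := gl_relLL aN aN bN aN.
rewrite (negbTE ab) aX !simp commutatorD_double => ->.
(* The relation yields $L_{b,a}h_a$; moving $h_a$ to the left costs the sign. *)
by apply/anticommutator_eq0/gl_Lh_anti; rewrite // ?inE ?eqxx ?orbT // eq_sym.
Qed.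

Lemma gl_eps_comm a b c : N a -> N b -> N c -> a != b -> a != c ->
  commutator (L a a) (L b c) = 0.
Proof.
move=> aN bN cN ab ac.
by apply: gl_LL_comm; rewrite // negb_and ?ab ?ac.
Qed.

(** * Serre relations and the quartic relation *)

(** Consecutive $a,b,c$ give $e_x$ against $e_{x+1}$ when increasing and $f_x$ against $f_{x-1}$
    when decreasing. *)
Lemma gl_serre_row a b c : N a -> N b -> N c -> a != b -> a != c -> b != c ->
  Xp a = Xp b -> commutator (L a b) (commutator (L a b) (L b c)) = 0.
Proof.
move=> aN bN cN ab ac bc abX; rewrite gl_LL_chain // commutatorNr.
have [aX|aX] := boolP (Xp a).
  rewrite commutatorMN ?oppr0 //; last exact: gl_LL_row.
  by apply: gl_Lh_anti; rewrite -?abX // !inE eqxx orbT.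
rewrite h_out -?abX // mul1r gl_LL_comm ?oppr0 // ?(negbTE aX) ?andbF //.
  by rewrite eq_sym.
by rewrite (negbTE bc).
Qed.

(** The mirror image, with the second step repeated: $e_x$ against $e_{x-1}$, or $f_x$ against
    $f_{x+1}$. *)
Lemma gl_serre_col a b c : N a -> N b -> N c -> a != b -> a != c -> b != c ->
  Xp b = Xp c -> commutator (L b c) (commutator (L b c) (L a b)) = 0.
Proof.
move=> aN bN cN ab ac bc bcX.
rewrite -(commutatorN (L a b)) gl_LL_chain // opprK.
have [bX|bX] := boolP (Xp b).
  apply: commutatorMN; last by apply: gl_LL_col; rewrite -?bcX // eq_sym.
  by apply: gl_Lh_anti; rewrite // !inE eqxx.
rewrite h_out // mul1r gl_LL_comm // -?bcX ?(negbTE bX) ?andbF //.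
by rewrite eq_sym.
Qed.

(** The inner commutators are $-h_cL_{b,d}$ and $-h_bL_{a,c}$, where $L_{b,d}$ and $L_{a,c}$
    commute. One of $h_b,h_c$ is 1; the other anticommutes with the $L$ factor of the opposite
    commutator, which produces the single sign. *)
Lemma gl_quartic a b c d : N a -> N b -> N c -> N d -> uniq [:: a; b; c; d] ->
  Xp b != Xp c ->
  anticommutator (commutator (L b c) (L c d)) (commutator (L a b) (L b c)) = 0.
Proof.
move=> aN bN cN dN; rewrite /= !inE !negb_or andbT.
move=> /andP[/and3P[ab ac ad] /andP[/andP[bc bd] cd]] bcX.
have /commutator_eq0 LL : commutator (L b d) (L a c) = 0.
  by apply: gl_LL_comm; rewrite // 1?eq_sym // negb_and ?ab ?cd.
rewrite !gl_LL_chain //; apply/anticommutator_eq0; rewrite !mulrNN.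
have [bX|bX] := boolP (Xp b); last first.
  have cX : Xp c by move: bcX; rewrite (negbTE bX); case: (Xp c).
  have /anticommutator_eq0 acH : anticommutator (L a c) (h c) = 0.
    by apply: gl_Lh_anti; rewrite // !inE eqxx orbT.
  by rewrite (h_out bX) mul1r mulrA acH mulNr opprK -!mulrA LL.
have cX : ~~ Xp c by move: bcX; rewrite bX; case: (Xp c).
have /anticommutator_eq0 bdH : anticommutator (L b d) (h b) = 0.
  by apply: gl_Lh_anti; rewrite // !inE eqxx.
by rewrite (h_out cX) mul1r mulrA bdH mulNr -!mulrA LL.
Qed.

End Relations.

(** * The relations for $e$, $f$, $\epsilon$ and $h$ in $\mathfrak{gl}_{k,m}$ over $\mathbb C$ *)

Theorem corollary2p6 (R : realType) (k m n : nat)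
    (nE : n = (k + m)%N) (kn : (1 <= k < n)%N) :
  let A : algType R[i] := gl R[i] k m in
  let h : nat -> A := @gl_h R[i] k m in
  let e : nat -> A := @gl_e R[i] k m in
  let f : nat -> A := @gl_f R[i] k m in
  let eps : nat -> A := @gl_eps R[i] k m in
  (forall x y : nat, in_Xplus k n x -> in_Xplus k n y ->
    commutator (h x) (h y) = 0) /\
  (forall z x : nat, in_segment n z -> in_segment n x ->
    commutator (eps z) (h x) = 0) /\
  (forall x z : nat, in_segment n.-1 x -> in_segment n z ->
    z <> x -> z <> x.+1 ->
    commutator (e x) (h z) = 0 /\ commutator (f x) (h z) = 0) /\
  (forall (xi : nat -> A) (x : nat), xi = e \/ xi = f ->
    in_Xplus k n x -> in_Xplus k n x.+1 ->
    anticommutator (xi x) (h x) = 0 /\ anticommutator (xi x) (h x.+1) = 0) /\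
  (forall x y : nat, in_segment n.-1 x -> in_segment n y ->
    y <> x -> y <> x.+1 ->
    commutator (eps y) (e x) = 0 /\ commutator (eps y) (f x) = 0) /\
  (forall x : nat, in_segment n.-1 x -> in_segment k x ->
    commutator (eps x) (e x) = - e x /\ commutator (eps x) (f x) = f x) /\
  (forall x : nat, in_segment n.-1 x -> in_segment k x.+1 ->
    commutator (eps x.+1) (e x) = e x /\
    commutator (eps x.+1) (f x) = - f x) /\
  (forall x : nat, in_segment n.-1 x -> in_Xplus k n x ->
    anticommutator (eps x) (e x) = h x * e x /\
    anticommutator (eps x) (f x) = - (h x * f x)) /\
  (forall x : nat, in_segment n.-1 x -> in_Xplus k n x.+1 ->
    anticommutator (eps x.+1) (e x) = - (h x.+1 * e x) /\
    anticommutator (eps x.+1) (f x) = h x.+1 * f x) /\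
  (forall x : nat, in_segment n.-1 x ->
    commutator (f x) (e x) = eps x * h x.+1 - eps x.+1 * h x) /\
  (forall x y : nat, in_segment k x -> in_segment k y -> x <> y ->
    commutator (f x) (e y) = 0) /\
  (forall x y : nat, in_Xplus k n x -> in_Xplus k n x.+1 ->
    in_segment n.-1 y -> y <> x -> y <> x.+1 -> y <> x.-1 ->
    commutator (f x) (e y) = 0) /\
  (forall x : nat, in_segment n.-1 x -> in_segment n.-1 x.+1 ->
    in_Xplus k n x.+1 -> anticommutator (f x) (e x.+1) = 0) /\
  (forall x : nat, in_segment n.-1 x -> in_segment n.-1 x.-1 ->
    in_Xplus k n x -> anticommutator (f x) (e x.-1) = 0) /\
  (e k ^+ 2 = 0 /\ f k ^+ 2 = 0) /\
  (forall (xi : nat -> A) (x y : nat), xi = e \/ xi = f ->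
    in_segment n.-1 x -> in_segment n.-1 y ->
    y = x.+1 \/ y = x.-1 -> x <> k ->
    xi y * xi x ^+ 2 + xi x ^+ 2 * xi y - 2 *: (xi x * xi y * xi x) = 0) /\
  (forall xi : nat -> A, xi = e \/ xi = f ->
    in_segment n.-1 k.-1 -> in_segment n.-1 k -> in_segment n.-1 k.+1 ->
    anticommutator (commutator (xi k.+1) (xi k))
                   (commutator (xi k) (xi k.-1)) = 0).
Proof.
subst n => A h e f eps; have {kn}/andP[k1 kn] := kn.
pose hinv : nat -> A := @gl_hinv R[i] k m.
pose L : nat -> nat -> A := @gl_L R[i] k m.
have rel (u v : A) : gl_rel k m h hinv L u v -> u = v by exact: gl_relE.
(* The default value of [free_h] is 1 beyond $n$ as well as on $[k]$. *)
have hout z : ~~ in_Xplus k (k + m) z -> h z = 1.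
  by move=> zX; rewrite /h /gl_h /free_h insubN // rmorph1.
have eE x : e x = L x x.+1 by [].
have fE x : f x = L x.+1 x by [].
have epsE x : eps x = L x x by [].
clearbody e f eps L h hinv; clearbody A.
(* Dividing by 2 serves only to get $e_k^2=f_k^2=0$. *)
have two_inj (u : A) : 2 * u = 0 -> u = 0.
  rewrite mulr_natl -scaler_nat => /(congr1 (GRing.scale 2^-1)).
  by rewrite scaler0 scalerA mulVf ?scale1r // Num.Theory.pnatr_eq0.
rewrite /in_segment /in_Xplus.
Ltac indices := rewrite /in_segment /in_Xplus /= ?inE; lia.
repeat match goal with |- _ /\ _ => split end.
- by move=> x y _ _; apply: (gl_hh_comm rel hout).
- by move=> z x zN _; rewrite epsE; apply: (gl_eps_h_comm rel hout).
- move=> x z xN zN zx zx1; rewrite eE fE.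
  by split; apply: (gl_Lh_comm rel hout); indices.
- move=> xi x [] -> xX x1X; rewrite ?eE ?fE.
    by split; apply: (gl_Lh_anti rel); indices.
  by split; apply: (gl_Lh_anti rel); indices.
- move=> x y xN yN yx yx1; rewrite eE fE epsE.
  by split; apply: (gl_eps_comm rel); indices.
- move=> x xN xk; rewrite eE fE epsE.
  split; first by apply: (gl_eps_row_lo rel hout); indices.
  by apply: (gl_eps_col_lo rel hout); indices.
- move=> x xN xk; rewrite eE fE epsE.
  split; first by apply: (gl_eps_col_lo rel hout); indices.
  by apply: (gl_eps_row_lo rel hout); indices.
- move=> x xN xX; rewrite eE fE epsE.
  split; first by apply: (gl_eps_row_hi rel); indices.
  by apply: (gl_eps_col_hi rel); indices.
- move=> x xN xX; rewrite eE fE epsE.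
  split; first by apply: (gl_eps_col_hi rel); indices.
  by apply: (gl_eps_row_hi rel); indices.
- by move=> x xN; rewrite eE fE !epsE; apply: (gl_LL_swap rel hout); indices.
(* A row or column shared by $f_x$ and $e_y$ has index at most $k$, so no correction term
   appears. *)
- move=> x y xk yk xy; rewrite eE fE.
  by apply: (gl_LL_comm rel); indices.
- move=> x y xX x1X yN yx yx1 yx'; rewrite eE fE.
  by apply: (gl_LL_comm rel); indices.
- move=> x xN x1N x1X; rewrite eE fE.
  by apply: (gl_LL_row rel); indices.
(* Both generators lie in column $x$, which is visible once [x.-1.+1] is rewritten as [x]. *)
- move=> x xN x1N xX; rewrite eE fE anticommutatorC prednK; last by lia.
  by apply: (gl_LL_col rel); indices.
- by rewrite eE; apply/two_inj/(gl_LL_square rel); indices.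
- by rewrite fE; apply/two_inj/(gl_LL_square rel); indices.
- move=> xi x y xiE xN yN yx xk.
  (* The goal becomes $[\xi_x,[\xi_x,\xi_y]]=0$; $x\ne k$ puts $x$ and $x+1$ on the same side of
     $k$. *)
  rewrite scaler_nat -mulr_natl -double_commutator.
  case: xiE => ->; case: yx => yE; subst y; rewrite ?eE ?fE.
  + by apply: (gl_serre_row rel hout); indices.
  + rewrite prednK; last by lia.
    by apply: (gl_serre_col rel hout); indices.
  + by apply: (gl_serre_col rel hout); indices.
  + rewrite prednK; last by lia.
    by apply: (gl_serre_row rel hout); indices.
- move=> xi [] -> k'N kN k1N; rewrite ?eE ?fE prednK //.
    (* For $e$ the indices $a,b,c,d$ are $k-1,k,k+1,k+2$; both inner commutators must be reversed,
       and the two signs cancel. *)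
    rewrite -[X in anticommutator X _]commutatorN.
    rewrite -[X in anticommutator _ X]commutatorN.
    rewrite /anticommutator !mulrNN -/(anticommutator _ _).
    by apply: (gl_quartic rel hout); indices.
  (* For $f$ the indices descend from $k+2$ to $k-1$, and only the two outer factors are
     exchanged. *)
  by rewrite anticommutatorC; apply: (gl_quartic rel hout); indices.
Qed.
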